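(* Let $\Phi:\{0,1\}^{\mathbb{Z}}\to\{0,1\}^{\mathbb{Z}}$ be a (one-dimensional) cellular automaton for which the uniform configurations $\underline{0}$ and $\underline{1}$ are fixed points, i.e. $\Phi\underline{0}=\underline{0}$ and $\Phi\underline{1}=\underline{1}$. Suppose that $\Phi$ washes out finite islands of errors on either of $\underline{0}$ and $\underline{1}$ in linear time; namely, suppose that there is a constant $m$ (a positive integer) such that for every positive integer $l$: for every finite perturbation $x$ of $\underline{0}$ for which $\operatorname{diff}(\underline{0},x)$ has diameter at most $l$ we have $\Phi^{ml}x=\underline{0}$, and for every finite perturbation $x$ of $\underline{1}$ for which $\operatorname{diff}(\underline{1},x)$ has diameter at most $l$ we have $\Phi^{ml}x=\underline{1}$. Then there is a constant $p_{\mathrm{c}}\in(0,1/2]$ such that for every $p\in[0,p_{\mathrm{c}})\cup(1-p_{\mathrm{c}},1]$, $\Phi$ classifies a Bernoulli random configuration with parameter $p$ almost surely correctly; that is, if $X$ is a Bernoulli random configuration with parameter $p$, then almost surely $\Phi^tX\to\underline{0}$ as $t\to\infty$ when $p<p_{\mathrm{c}}$, and almost surely $\Phi^tX\to\underline{1}$ as $t\to\infty$ when $p>1-p_{\mathrm{c}}$.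
   Context: A configuration is a function $x:\mathbb{Z}\to\{0,1\}$, with $x_i$ denoting the symbol at site $i$. A cellular automaton is a map $\Phi:\{0,1\}^{\mathbb{Z}}\to\{0,1\}^{\mathbb{Z}}$ of the form $(\Phi x)_i=f(x_{i-r},x_{i-r+1},\ldots,x_{i+r})$ for all $i\in\mathbb{Z}$, for some fixed integer $r\ge 0$ (the neighborhood radius) and some fixed local update rule $f:\{0,1\}^{2r+1}\to\{0,1\}$; $\Phi^t$ denotes the $t$-th iterate. For $a\in\{0,1\}$, $\underline{a}$ is the uniform configuration with symbol $a$ at every site. For configurations $x,y$, $\operatorname{diff}(x,y)=\{i\in\mathbb{Z}: x_i\neq y_i\}$. A configuration $x$ is a finite perturbation of $z$ if $\operatorname{diff}(z,x)$ is finite. A set of sites has diameter at most $l$ if it is covered by an interval of length $l$, i.e. by a set of $l$ consecutive integers. Convergence of configurations is site-wise eventual agreement (the product topology): $x^{(n)}\to x$ means that for each $i\in\mathbb{Z}$ there is $n_i$ such that $x^{(n)}_i=x_i$ for all $n\ge n_i$. A Bernoulli random configuration with parameter $p$ is a random configuration $X$ whose symbols $X_i$, $i\in\mathbb{Z}$, are independent with $\mathbb{P}(X_i=1)=p$ and $\mathbb{P}(X_i=0)=1-p$. The density of $1$'s in $x$ is $\rho(x)=\lim_{N\to\infty}\frac{|\{i\in[-N,N]:x_i=1\}|}{2N+1}$ when the limit exists; $\Phi$ classifies $x$ according to density if $\Phi^tx\to\underline{0}$ or $\Phi^tx\to\underline{1}$ as $t\to\infty$, depending on whether $\rho(x)<1/2$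 or $\rho(x)>1/2$. For a Bernoulli random configuration with parameter $p$, the density is almost surely equal to $p$. *)

(* Defs.v *)
(* MathComp world: MathComp and MathComp-Analysis. *)
From HB Require Import structures.
From mathcomp Require Import all_boot all_order all_algebra finmap.
From mathcomp Require Import all_classical all_reals all_analysis.

Set Implicit Arguments.
Unset Strict Implicit.
Unset Printing Implicit Defensive.

Import Order.TTheory GRing.Theory Num.Theory.

Local Open Scope classical_set_scope.
Local Open Scope ring_scope.

(* The symbols 0 and 1 are encoded as [false] and [true]. *)
Definition config := int -> bool.

Definition uniform_config (a : bool) : config := fun=> a.

(* Entry j of the (2r+1)-tuple passed to the local rule f is the symbol at
   site i - r + j. *)
Definition cellular_automaton (Phi : config -> config) : Prop :=
  exists (r : nat) (f : (r.*2.+1).-tuple bool -> bool),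
    forall (x : config) (i : int),
      Phi x i = f [tuple x (i - r%:Z + (j : nat)%:Z) | j < r.*2.+1].

Definition diff_sites (x y : config) : set int := [set i | x i <> y i].

Definition finite_perturbation (z x : config) : Prop := finite_set (diff_sites z x).

Definition diameter_le (A : set int) (l : nat) : Prop :=
  exists a : int, A `<=` [set i | a <= i < a + l%:Z].

Definition washes_out (Phi : config -> config) (z : config) (m : nat) : Prop :=
  forall l : nat, (0 < l)%N -> forall x : config,
    finite_perturbation z x -> diameter_le (diff_sites z x) l ->
    iter (m * l) Phi x = z.

(* Convergence in the product topology, {0,1} being discrete. *)
Definition config_cvg (u : nat -> config) (x : config) : Prop :=
  forall i : int, exists n_i : nat,
    forall n : nat, (n_i <= n)%N -> u n i = x i.

Definition mutually_independent (d d' : measure_display)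
    (T : measurableType d) (T' : measurableType d') (R : realType)
    (P : probability T R) (I : choiceType) (X : I -> {RV P >-> T'}) : Prop :=
  forall (J : {fset I}) (A : I -> set T'), (forall i, measurable (A i)) ->
    P (\bigcap_(i in [set` J]) (X i @^-1` A i)) =
    (\prod_(i <- J) P (X i @^-1` A i))%E.

Definition bernoulli_config (d : measure_display) (T : measurableType d)
    (R : realType) (P : probability T R) (p : R)
    (X : int -> {RV P >-> bool}) : Prop :=
  mutually_independent X /\
  forall i : int, P [set w | X i w = true] = p%:E /\
                  P [set w | X i w = false] = (1 - p)%:E.

(* Main.v *)
(* Let E be the set of sites where X differs from the uniform configuration.
   Level by level, erase from E the clusters of radius 2 K ^ k that are isolated
   up to distance (K - 1) K ^ k.  By locality these clusters evolve
   independently until they are washed out, so erasing them does not change the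
   configuration at times t >= 5 m K ^ k, where K = 10 r m + 3.  A site surviving
   k erasures is explained by 2 ^ k distinct errors within distance K ^ k, chosen
   along a binary tree; there are at most C ^ (2 ^ k) such trees.  For a small
   error density q, independence and the union bound make the probability of a
   survivor near a given site at most (C q) ^ (2 ^ k), and Borel-Cantelli
   concludes. *)
Require Import Defs.
From HB Require Import structures.
From mathcomp Require Import all_boot all_order all_algebra finmap.
From mathcomp Require Import all_classical all_reals all_analysis.
From mathcomp Require Import zify ring lra.

Set Implicit Arguments.
Unset Strict Implicit.
Unset Printing Implicit Defensive.

Import Order.TTheory GRing.Theory Num.Theory.

Local Open Scope classical_set_scope.
Local Open Scope ring_scope.

(** * Locality, and configurations encoded by error sets *)

Definition local_radius (r : nat) (Phi : config -> config) : Prop :=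
  forall (x y : config) (i : int),
    (forall j : int, `|j - i| <= r%:Z -> x j = y j) -> Phi x i = Phi y i.

Lemma cellular_automaton_local (Phi : config -> config) :
  cellular_automaton Phi -> exists r, local_radius r Phi.
Proof.
move=> [r [f Phif]]; exists r => x y i xy.
rewrite !Phif; congr f; apply: eq_from_tnth => j.
by rewrite !tnth_mktuple; apply: xy; have := ltn_ord j; lia.
Qed.

Lemma iter_local (r : nat) (Phi : config -> config) (t : nat) :
  local_radius r Phi -> local_radius (r * t) (iter t Phi).
Proof.
move=> rPhi; elim: t => [|t IHt] x y i xy; first by apply: xy; lia.
by apply: rPhi => j ji; apply: IHt => k kj; apply: xy; lia.
Qed.

(** Exclusive or with the indicator of the error set treats perturbations of both uniform
    configurations at once. *)
Definition error_config (a : bool) (E : set int) : config :=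
  fun i => a (+) `[< E i >].

Lemma error_configE (a : bool) (x : config) :
  x = error_config a (diff_sites (uniform_config a) x).
Proof.
apply/funext => i; rewrite /error_config /diff_sites /uniform_config /=.
by case: asboolP; case: a; case: (x i) => // -[].
Qed.

Lemma error_config0 (a : bool) (E : set int) (i : int) :
  ~ E i -> error_config a E i = a.
Proof. by rewrite /error_config => /asboolPn/negbTE ->; rewrite addbF. Qed.

(** * Erasing isolated clusters, level by level *)

Definition island_center (inner outer : nat) (E : set int) (z : int) : Prop :=
  E z /\ forall y, E y -> `|y - z| <= outer%:Z -> `|y - z| <= inner%:Z.

Definition erase (inner outer : nat) (E : set int) : set int :=
  [set x | E x /\ forall z, island_center inner outer E z -> inner%:Z < `|x - z|].

Lemma diff_error_config (a : bool) (E : set int) :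
  diff_sites (uniform_config a) (error_config a E) = E.
Proof.
apply/seteqP; rewrite /diff_sites /error_config /uniform_config.
by split=> i /=; case: asboolP; case: a.
Qed.

Lemma diameter_le_finite (A : set int) (l : nat) :
  diameter_le A l -> finite_set A.
Proof.
move=> [b Ab]; apply: (@sub_finite_set _ _ ((fun n : nat => b + n%:Z) @` `I_l)).
  move=> i /Ab /= ib; exists `|i - b|%N => /=; lia.
exact/finite_image/finite_II.
Qed.

Section erase.
Variables (Phi : config -> config) (a : bool) (r m : nat).
Hypotheses (Phi_local : local_radius r Phi)
  (Phi_washes : washes_out Phi (uniform_config a) m).

(** By time [m * l], site [i] depends only on sites within [r * (m * l)]. If this cone contains an
    error of an island, the bound on [outer] forces every error in the cone into that island, so the
    site sees a single washed-out cluster. Otherwise erasure changes nothing in the cone. *)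
Lemma iter_erase (inner outer l : nat) (E : set int) (t : nat) :
  (inner.*2 < l)%N -> (inner + (r * (m * l)).*2 <= outer)%N -> (m * l <= t)%N ->
  iter t Phi (error_config a E) = iter t Phi (error_config a (erase inner outer E)).
Proof.
move=> il lo mlt; rewrite -(subnK mlt) !iterD; congr iter.
apply/funext => i.
have loc := iter_local (t := m * l) Phi_local.
have [[z [/= zC [u [Eu uz ui]]]]|nz] := pselect (exists z,
    island_center inner outer E z /\
    exists u, [/\ E u, `|u - z| <= inner%:Z & `|u - i| <= (r * (m * l))%:Z]).
  pose I := E `&` [set y | `|y - z| <= inner%:Z].
  have Ez y : `|y - i| <= (r * (m * l))%:Z -> E y -> `|y - z| <= inner%:Z.
    by move=> yi Ey; apply: zC.2 => //; lia.
  have diamI : diameter_le I l by exists (z - inner%:Z) => y [_ /=]; lia.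
  (* Applied to [I] itself and to the empty set, since the erased set has no site in the cone. *)
  have wash J : J `<=` I -> iter (m * l) Phi (error_config a J) = uniform_config a.
    move=> JI; have dJ : diameter_le J l.
      by have [b Ib] := diamI; exists b; apply: subset_trans Ib.
    apply: Phi_washes; first by lia.
      by rewrite /finite_perturbation diff_error_config; apply: diameter_le_finite dJ.
    by rewrite diff_error_config.
  transitivity (iter (m * l) Phi (error_config a I) i).
    apply: loc => j ji; rewrite /error_config; congr addb.
    by apply/asbool_equiv_eq; split=> [Ej|[]//]; split=> //=; apply: Ez.
  rewrite wash// -(wash set0)//; apply: loc => j ji.
  rewrite !error_config0// => -[Ej /(_ z zC)].
  by have := Ez j ji Ej; lia.
apply: loc => j ji; rewrite /error_config; congr addb.
apply/asbool_equiv_eq; split=> [Ej|[]//]; split=> // z zC.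
rewrite ltNge; apply/negP => jz; apply: nz; exists z; split=> //.
by exists j.
Qed.

End erase.

(* The outer radius (K - 1) K ^ k makes K ^ k + (K - 1) K ^ k = K ^ k.+1 bound
   the spread of the explanations of the survivors. *)
Fixpoint survivors (K : nat) (E : set int) (k : nat) : set int :=
  if k is k'.+1
  then erase (2 * K ^ k') (K.-1 * K ^ k') (survivors K E k')
  else E.

Lemma iter_survivors (Phi : config -> config) (a : bool) (r m : nat)
    (E : set int) (k t : nat) :
  let K := (10 * r * m + 3)%N in
  local_radius r Phi -> washes_out Phi (uniform_config a) m ->
  (m * (5 * K ^ k) <= t)%N ->
  iter t Phi (error_config a E) = iter t Phi (error_config a (survivors K E k)).
Proof.
move=> K Phir Phim; elim: k t => [//|k IHk] t kt.
have K0 : (0 < K ^ k)%N by rewrite expn_gt0 /K addn_gt0 orbT.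
have kt' : (m * (5 * K ^ k) <= t)%N.
  by apply: leq_trans kt; rewrite !leq_mul2l expnS leq_pmull ?orbT// /K addn_gt0 orbT.
(* With [inner] equal to 2 K ^ k, the length 5 K ^ k exceeds 4 K ^ k, and [outer] must be at least
   (2 + 10 r m) K ^ k, which is exactly (K - 1) K ^ k. *)
rewrite IHk//=; apply: (@iter_erase Phi a r m Phir Phim _ _ (5 * K ^ k)) => //; first lia.
by rewrite /K addn3 /= -addn2 -/K -addn3 -/K; nia.
Qed.

Lemma iter_uniform (Phi : config -> config) (a : bool) (t : nat) :
  Phi (uniform_config a) = uniform_config a ->
  iter t Phi (uniform_config a) = uniform_config a.
Proof. by move=> Phia; elim: t => //= t ->. Qed.

Lemma config_cvg_survivors (Phi : config -> config) (a : bool) (r m : nat) (x : config) :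
  let K := (10 * r * m + 3)%N in
  let E := diff_sites (uniform_config a) x in
  local_radius r Phi -> (0 < m)%N -> washes_out Phi (uniform_config a) m ->
  Phi (uniform_config a) = uniform_config a ->
  (forall i : int, exists n : nat, forall k : nat, (n <= k)%N ->
    forall j : int, `|j - i| <= (K ^ k.+2)%:Z -> ~ survivors K E k j) ->
  config_cvg (fun t => iter t Phi x) (uniform_config a).
Proof.
move=> K E Phir m0 Phim Phia noE i.
have [n nE] := noE i; exists (m * (5 * K ^ n))%N => t nt.
have K1 : (1 < K)%N by rewrite /K addnC.
(* The level is matched to the time: late enough for k erasures to be harmless, early enough for the
   cone radius r t to be at most 5 r m K ^ k.+1, hence at most K ^ k.+2. *)
have [k [nk kt tk]] : exists k, [/\ (n <= k)%N, (m * (5 * K ^ k) <= t)%N &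
    (t <= m * (5 * K ^ k.+1))%N].
  pose Q k := (t <= m * (5 * K ^ k.+1))%N.
  have exQ : exists k, (n <= k)%N && Q k.
    exists (n + t)%N; rewrite leq_addr /Q.
    have := ltn_expl (n + t).+1 K1; nia.
  case: (ex_minnP exQ) => k /andP[nk Qk] kmin; exists k; split=> //.
  have [->//|nk'] := eqVneq k n.
  case: k nk Qk kmin nk' => [|k] nk Qk kmin nk'; first by lia.
  have [//|tk] := leqP; have := kmin k; rewrite /Q (ltnW tk); lia.
rewrite [x](error_configE a) -/E (@iter_survivors _ _ r m _ k)//.
rewrite -[in RHS](iter_uniform t Phia).
apply: (iter_local (t := t) Phir) => j ji; rewrite error_config0//.
apply: nE nk _ _; apply: le_trans ji _; rewrite lez_nat.
apply: (@leq_trans (r * (m * (5 * K ^ k.+1)))); first by rewrite leq_mul2l tk orbT.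
by rewrite [leqRHS]expnS {2}/K; nia.
Qed.

(** * Explaining survivors by binary trees of errors *)

Definition window (x : int) (n : nat) : seq int :=
  [seq x - n%:Z + j%:Z | j <- iota 0 n.*2.+1].

Lemma mem_window (x : int) (n : nat) (y : int) :
  (y \in window x n) = (`|y - x| <= n%:Z).
Proof.
apply/mapP/idP => [[j]|yx]; first by rewrite mem_iota => jn ->; lia.
by exists (absz (y - x + n%:Z)); rewrite ?mem_iota; lia.
Qed.

(** Leaf sequences of binary trees of depth [k]: one subtree keeps the root [x], the other is rooted
    in the annulus that would be free of errors if [x] were an island center. *)
Fixpoint explanations (K k : nat) (x : int) : seq (seq int) :=
  if k is k'.+1 then
    flatten [seq [seq s ++ t | s <- explanations K k' x, t <- explanations K k' y]
            | y <- window x (K.-1 * K ^ k') & (2 * K ^ k')%:Z < `|y - x|]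
  else [:: [:: x]].

Lemma explanationsP (K k : nat) (x : int) (s : seq int) :
  reflect (exists y, [/\ (2 * K ^ k)%:Z < `|y - x|, `|y - x| <= (K.-1 * K ^ k)%:Z &
      exists s1 s2, [/\ s1 \in explanations K k x, s2 \in explanations K k y &
        s = s1 ++ s2]])
    (s \in explanations K k.+1 x).
Proof.
apply: (iffP flatten_mapP) => [[y]|[y [xy yx [s1 [s2 [s1x s2y ->]]]]]].
  rewrite mem_filter mem_window => /andP[xy yx] /allpairsP[[s1 s2] /= [? ? ->]].
  by exists y; split=> //; exists s1, s2.
exists y; first by rewrite mem_filter mem_window xy.
by apply/allpairsP; exists (s1, s2).
Qed.

Lemma explanations_near (K k : nat) (x : int) (s : seq int) (i : int) :
  (0 < K)%N -> s \in explanations K k x -> i \in s -> `|i - x| <= (K ^ k)%:Z.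
Proof.
move=> K0; elim: k x s => [|k IHk] x s.
  by rewrite inE => /eqP ->; rewrite inE => /eqP ->; lia.
move=> /explanationsP[y [_ yx [s1 [s2 [s1x s2y ->]]]]]; rewrite mem_cat.
have Kk : (K ^ k.+1 = K ^ k + K.-1 * K ^ k)%N by rewrite expnS; nia.
by case/orP => [/(IHk _ _ s1x)|/(IHk _ _ s2y)]; lia.
Qed.

(* The two halves of an explanation stay within K ^ k of their roots, which are
   more than 2 K ^ k apart, so they are disjoint. *)
Lemma explanations_uniq (K k : nat) (x : int) (s : seq int) :
  (0 < K)%N -> s \in explanations K k x -> uniq s /\ size s = (2 ^ k)%N.
Proof.
move=> K0; elim: k x s => [|k IHk] x s; first by rewrite inE => /eqP ->.
move=> /explanationsP[y [xy _ [s1 [s2 [s1x s2y ->]]]]].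
have [us1 ss1] := IHk _ _ s1x; have [us2 ss2] := IHk _ _ s2y.
rewrite cat_uniq us1 us2 size_cat ss1 ss2 addnn expnS mul2n andbT; split=> //.
apply/hasPn => i /(explanations_near K0 s2y) iy; apply/negP.
by move=> /(explanations_near K0 s1x); lia.
Qed.

(** A survivor is at distance 0 from itself, so it is not an island center; its annulus therefore
    contains another survivor of the previous level, and the two explanations are concatenated. *)
Lemma survivors_explained (K : nat) (E : set int) (k : nat) (x : int) :
  survivors K E k x ->
  exists2 s, s \in explanations K k x & forall i, i \in s -> E i.
Proof.
elim: k x => [|k IHk] x.
  by move=> Ex; exists [:: x] => [|i]; rewrite inE// => /eqP ->.
move=> [Ex /(_ x) nx].
have /existsNP[y] : ~ forall y, survivors K E k y ->
    `|y - x| <= (K.-1 * K ^ k)%:Z -> `|y - x| <= (2 * K ^ k)%:Z.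
  by move=> iso; have := nx (conj Ex iso); lia.
move=> /not_implyP[Ey /not_implyP[yx /negP]]; rewrite -ltNge => xy.
have [s sx sE] := IHk _ Ex; have [t ty tE] := IHk _ Ey.
exists (s ++ t); last by move=> i; rewrite mem_cat => /orP[/sE|/tE].
by apply/explanationsP; exists y; split=> //; exists s, t.
Qed.

(* The number N k of explanations satisfies N k.+1 <= 2 K ^ k.+1 (N k) ^ 2; the
   weight (2 K) ^ k.+2 absorbs the prefactor. *)
Lemma size_explanations (K k : nat) (x : int) : (0 < K)%N ->
  (size (explanations K k x) * (2 * K) ^ k.+2 <= ((2 * K) ^ 2) ^ (2 ^ k))%N.
Proof.
move=> K0.
suff [n nE nK] : exists2 n, forall y, (size (explanations K k y) <= n)%N &
    (n * (2 * K) ^ k.+2 <= ((2 * K) ^ 2) ^ (2 ^ k))%N.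
  by apply: leq_trans nK; rewrite leq_mul2r nE orbT.
elim: k => [|k [n nE nK]]; first by exists 1%N => //; rewrite mul1n expn1.
exists (2 * K ^ k.+1 * (n * n))%N => [{}x|].
  have size_flatten_le ys : (size (flatten [seq [seq s ++ t |
      s <- explanations K k x, t <- explanations K k y] | y <- ys]) <= size ys * (n * n))%N.
    elim: ys => //= y ys IHys.
    by rewrite size_cat size_allpairs mulSn leq_add// leq_mul.
  apply: leq_trans (size_flatten_le [seq y <- window x (K.-1 * K ^ k) |
    (2 * K ^ k)%:Z < `|y - x|]) _.
  rewrite leq_mul2r size_filter (leq_trans (count_size _ _)) ?orbT//.
  rewrite size_map size_iota expnS.
  by have : (0 < K ^ k)%N by [rewrite expn_gt0 K0]; nia.
rewrite (expnS 2 k) [(2 * 2 ^ k)%N]mulSn mul1n expnD.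
apply: leq_trans _ (leq_mul nK nK).
have : (2 * K ^ k.+1 <= (2 * K) ^ k.+1)%N.
  by rewrite expnMn leq_mul2r -[X in (X <= _)%N]expn1 leq_exp2l ?orbT.
rewrite (expnS _ k.+2) (expnS (2 * K) k.+1).
move: (K ^ k.+1)%N ((2 * K) ^ k.+1)%N => u v uv.
rewrite [leqRHS](_ : _ = v * (n * n) * (2 * K * (2 * K * v)))%N; last by ring.
by rewrite !leq_mul2r uv !orbT.
Qed.

(** * Union bound and Borel-Cantelli *)

Section probability.
Context d (T : measurableType d) (R : realType) (P : probability T R).
Variables (q : R) (X : int -> {RV P >-> bool}) (a : bool).
Hypotheses (Xind : mutually_independent X)
  (Xq : forall i, P [set w | X i w = ~~ a] = q%:E).

Lemma measurable_error (i : int) : measurable [set w | X i w = ~~ a].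
Proof.
rewrite [X in measurable X](_ : _ = X i @^-1` [set ~~ a])//.
by rewrite -[X in measurable X]setTI; apply: (measurable_funPT (X i)).
Qed.

Definition all_errors (s : seq int) : set T :=
  \bigcap_(i in [set` s]) [set w | X i w = ~~ a].

Lemma measurable_all_errors (s : seq int) : measurable (all_errors s).
Proof.
by apply: fin_bigcap_measurable => // i _; apply: measurable_error.
Qed.

(** Independence is stated over finite sets; distinct entries ensure that there are [size s]
    factors. *)
Lemma probability_all_errors (s : seq int) :
  uniq s -> P (all_errors s) = (q ^+ size s)%:E.
Proof.
move=> us; pose J : {fset int} := seq_fset tt s.
have JE : [set` J] = [set` s] by apply/seteqP; split=> i /=; rewrite seq_fsetE.
have := Xind J (A := fun=> [set ~~ a]) (fun=> Logic.I); rewrite JE => ->.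
rewrite (eq_bigr (fun=> q%:E)) => [|i _]; last exact: Xq.
rewrite prodEFin big_const_seq count_predT iter_mulr_1 size_seq_fset.
by rewrite undup_id.
Qed.

Lemma probability_bigsetU_le (I : eqType) (s : seq I) (A : I -> set T) (c : R) :
  (forall i, measurable (A i)) -> (forall i, i \in s -> (P (A i) <= c%:E)%E) ->
  (P (\big[setU/set0]_(i <- s) A i) <= (c *+ size s)%:E)%E.
Proof.
move=> mA; elim: s => [|i s IHs] Ac; first by rewrite big_nil measure0.
rewrite big_cons; apply: le_trans (measureU2 _ _ _) _ => //.
  exact: bigsetU_measurable.
rewrite /= mulrS EFinD leeD ?Ac ?mem_head// IHs// => j js.
by rewrite Ac// in_cons js orbT.
Qed.

Definition window_explanations (K k : nat) (i : int) : seq (seq int) :=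
  flatten [seq explanations K k j | j <- window i (K ^ k.+2)].

Definition explained_errors (K : nat) (i : int) (k : nat) : set T :=
  \big[setU/set0]_(s <- window_explanations K k i) all_errors s.

Lemma measurable_explained_errors (K : nat) (i : int) (k : nat) :
  measurable (explained_errors K i k).
Proof. by apply: bigsetU_measurable => s _; apply: measurable_all_errors. Qed.

(** The window has 2 K ^ k.+2 + 1 sites, at most (2 K) ^ k.+2, so the weight in [size_explanations]
    pays for the choice of root. *)
Lemma size_window_explanations (K k : nat) (i : int) : (0 < K)%N ->
  (size (window_explanations K k i) <= ((2 * K) ^ 2) ^ (2 ^ k))%N.
Proof.
move=> K0; rewrite -(leq_pmul2r (_ : 0 < (2 * K) ^ k.+2))%N; last first.
  by rewrite expn_gt0 muln_gt0 K0.
have size_flatten_le ys : (size (flatten [seq explanations K k j | j <- ys])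
    * (2 * K) ^ k.+2 <= size ys * ((2 * K) ^ 2) ^ (2 ^ k))%N.
  elim: ys => //= y ys IHys.
  by rewrite size_cat mulnDl mulSn leq_add// size_explanations.
apply: leq_trans (size_flatten_le _) _; rewrite mulnC leq_mul2l.
apply/orP; right; rewrite size_map size_iota expnMn.
have : (0 < K ^ k.+2)%N by rewrite expn_gt0 K0.
have : (0 < 2 ^ k)%N by rewrite expn_gt0.
rewrite (expnS 2 k.+1) (expnS 2 k).
by move: (2 ^ k)%N (K ^ k.+2)%N => u v; nia.
Qed.

(** The bound (1 / 2) ^ (2 ^ k) is weakened through k < 2 ^ k to a geometric term, the form summed
    by [epsilon_trick0]. *)
Lemma explained_errors_le (K : nat) (i : int) (k : nat) :
  (0 < K)%N -> 0 <= q -> q * ((2 * K) ^ 2)%:R <= 1 / 2 ->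
  (P (explained_errors K i k) <= (1 / (2 ^ k.+1)%:R)%:E)%E.
Proof.
move=> K0 q0 qK.
apply: (@le_trans _ _ (q ^+ (2 ^ k) *+ size (window_explanations K k i))%:E).
  apply: probability_bigsetU_le => [s|s]; first exact: measurable_all_errors.
  move=> /flatten_mapP[j _ /(explanations_uniq K0)[us <-]].
  by rewrite probability_all_errors.
rewrite lee_fin -mulr_natr.
apply: (@le_trans _ _ ((q * ((2 * K) ^ 2)%:R) ^+ (2 ^ k))).
  rewrite exprMn -natrX ler_wpM2l ?exprn_ge0// ler_nat.
  exact: size_window_explanations.
apply: (@le_trans _ _ ((1 / 2) ^+ (2 ^ k))).
  by rewrite lerXn2r ?nnegrE// mulr_ge0.
rewrite natrX !div1r -exprVn ler_wiXn2l ?invr_ge0 ?invf_le1 ?ler1n//.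
exact: ltn_expl.
Qed.

Lemma ae_no_survivors (K : nat) :
  (0 < K)%N -> 0 <= q -> q * ((2 * K) ^ 2)%:R <= 1 / 2 ->
  {ae P, forall w, forall i : int, exists n : nat, forall k : nat, (n <= k)%N ->
    forall j : int, `|j - i| <= (K ^ k.+2)%:Z ->
      ~ survivors K (diff_sites (uniform_config a) (fun i => X i w)) k j}.
Proof.
move=> K0 q0 qK.
pose F i := explained_errors K i.
have F0 i : P (lim_sup_set (F i)) = 0%E.
  apply: lim_sup_set_cvg0 => [k|]; first exact: measurable_explained_errors.
  apply: (@le_lt_trans _ _ 1%E); last exact: ltry.
  apply: le_trans (epsilon_trick0 xpredT (ler01)) => //.
  by apply: lee_nneseries => [k _ _|k _] //; apply: explained_errors_le.
(* Sites are enumerated by their codes, so that countably many null sets are combined; a number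
   coding no site imposes no condition. *)
have aeF (n : nat) : {ae P, forall w, forall i, @choice.unpickle int n = Some i ->
    ~ lim_sup_set (F i) w}.
  case: choice.unpickle => [i|]; last by apply: aeW.
  exists (lim_sup_set (F i)); split=> //.
    by apply: bigcap_measurable => // k _; apply: bigcup_measurable => l _;
      apply: measurable_explained_errors.
  by move=> w /= nw; apply: contrapT => nF; apply: nw => _ [<-].
move: (ae_foralln aeF); apply: filterS => w nF i.
have /existsNP[n /not_implyP[_ nFn]] := nF _ i (choice.pickleK i).
exists n => k nk j ji /survivors_explained[s sj sX]; apply: nFn.
exists k => //; rewrite /F /explained_errors -bigcup_seq; exists s => /=.
  by apply/flatten_mapP; exists j; rewrite ?mem_window.
move=> l /sX; rewrite /diff_sites /uniform_config /=.
by case: a; case: (X l w).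
Qed.

End probability.

Theorem corollary2 (R : realType) (Phi : config -> config)
    (Phi_CA : cellular_automaton Phi)
    (fixed0 : Phi (uniform_config false) = uniform_config false)
    (fixed1 : Phi (uniform_config true) = uniform_config true)
    (washes : exists m : nat, [/\ (0 < m)%N,
        washes_out Phi (uniform_config false) m & washes_out Phi (uniform_config true) m]) :
  exists pc : R, 0 < pc <= 1 / 2 /\
    forall p : R, 0 <= p <= 1 ->
    forall (d : measure_display) (T : measurableType d)
      (P : probability T R) (X : int -> {RV P >-> bool}),
      bernoulli_config p X ->
      (p < pc -> {ae P, forall w : T,
         config_cvg (fun t : nat => iter t Phi (fun i => X i w))
           (uniform_config false)}) /\
      (1 - pc < p -> {ae P, forall w : T,
         config_cvg (fun t : nat => iter t Phi (fun i => X i w))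
           (uniform_config true)}).
Proof.
have [r Phir] := cellular_automaton_local Phi_CA.
have [m [m0 washes0 washes1]] := washes.
pose K := (10 * r * m + 3)%N.
have K0 : (0 < K)%N by rewrite /K addnC.
pose Q : R := ((2 * K) ^ 2)%:R.
have Q1 : 1 <= Q by rewrite ler1n expn_gt0 muln_gt0 K0.
(* Here [q] is the error probability: p around the uniform 0, and 1 - p around the uniform 1. *)
have ae_cvg (q : R) d (T : measurableType d) (P : probability T R)
    (X : int -> {RV P >-> bool}) (a : bool) :
    0 <= q -> q < 1 / 2 / Q -> mutually_independent X ->
    (forall i, P [set w | X i w = ~~ a] = q%:E) ->
    {ae P, forall w, config_cvg (fun t => iter t Phi (fun i => X i w))
      (uniform_config a)}.
  move=> q0 qQ Xind Xq.
  have qK : q * Q <= 1 / 2 by rewrite -ler_pdivlMr ?(ltW qQ)// (lt_le_trans ltr01).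
  move: (ae_no_survivors Xind Xq K0 q0 qK); apply: filterS => w.
  by apply: config_cvg_survivors => //; case: a {Xq}.
(* Below this threshold q Q is at most 1 / 2, as the union bound requires; it is at most 1 / 2
   because Q is at least 1. *)
exists (1 / 2 / Q); split.
  have Q0 : 0 < Q by exact: lt_le_trans Q1.
  by apply/andP; split; [rewrite !divr_gt0|rewrite ler_pdivrMr// ler_peMr].
move=> p /andP[p0 p1] d T P X [Xind Xp]; split=> pc.
  exact: (ae_cvg p d T P X false p0 pc Xind (fun i => (Xp i).1)).
by apply: (ae_cvg (1 - p) d T P X true _ _ Xind (fun i => (Xp i).2)); lra.
Qed.
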